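(* For every sufficiently large integer $t$ there is a tree $T_t$ with independence number $\alpha(T_t) = (1+t)\lfloor 2^{t/16}\rfloor$ for which log-concavity of the independent set sequence is broken at $t\lfloor 2^{t/16}\rfloor+2$; that is, writing $k = t\lfloor 2^{t/16}\rfloor+2$, $$ i_{k}(T_t)^2 < i_{k-1}(T_t)\, i_{k+1}(T_t). $$
   Context: For a graph $G$, an independent set is a set of vertices no two of which are adjacent; $\alpha(G)$ denotes the size of a largest independent set in $G$, and $i_k(G)$ denotes the number of independent sets in $G$ of cardinality $k$. The independent set sequence of $G$ is $(i_k(G))_{k=0}^{\alpha(G)}$. Log-concavity of a positive sequence $(a_k)$ is said to be broken at $k$ if $a_k^2 < a_{k-1}a_{k+1}$. Here $\lfloor x\rfloor$ denotes the integer part of $x$. *)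

(* Defs.v *)
From mathcomp Require Import all_boot all_order all_algebra.
From mathcomp Require Import reals exp.

Set Implicit Arguments.
Unset Strict Implicit.
Unset Printing Implicit Defensive.

Record sgraph := SGraph {
  vertex :> finType;
  edge : rel vertex;
  edge_sym : symmetric edge;
  edge_irrefl : irreflexive edge
}.

Definition connected (G : sgraph) : Prop :=
  forall x y : G, connect (@edge G) x y.

(* The bound on the size excludes the degenerate closed walk x, y, x along a
   single edge, which is a [ucycle] of size 2. *)
Definition acyclic (G : sgraph) : Prop :=
  forall c : seq G, 2 < size c -> ~ ucycle (@edge G) c.

Definition tree (G : sgraph) : Prop :=
  [/\ 0 < #|G|, connected G & acyclic G].

Definition independent (G : sgraph) (A : {set G}) : bool :=
  [forall x in A, forall y in A, ~~ edge x y].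

Definition alpha (G : sgraph) : nat :=
  \max_(A : {set G} | independent A) #|A|.

Definition indep_count (G : sgraph) (k : nat) : nat :=
  #|[set A : {set G} | independent A & #|A| == k]|.

(* The index [k.-1] is truncated, so this is meaningful for [0 < k] only. *)
Definition log_concavity_broken_at (a : nat -> nat) (k : nat) : Prop :=
  a k ^ 2 < a k.-1 * a k.+1.

Definition floor_pow2_16 (R : realType) (t : nat) : nat :=
  Num.truncn (powR (2%:R : R) (t%:R / 16%:R))%R.

(* Main.v *)
(* Take the tree in which the root has [m] children, each of these has [t]
   children, and each of those has a single leaf child; here
   [m = floor (2 ^ (t / 16))].  Put [q = 2 ^ t].  Choosing one end of each of the
   [t * m] pendant edges, together with the root, gives at least [q ^ m]
   independent sets of size [t * m + 1]; replacing the root by three of its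
   children gives at least [q ^ (m - 3)] of size [t * m + 3].  A set of size
   [t * m + 2] cannot contain the root, so it contains [s >= 2] children of the
   root and misses [s - 2] pendant edges.  There are at most
   [sum_s 'C(m, s) * 'C(t * m, s - 2) * q ^ (m - s)] such sets, which a
   geometric series bounds by [2 * m ^ 2 * q ^ (m - 2)].  Since
   [4 * m ^ 4 < q], log-concavity fails. *)

Require Import Defs.
From mathcomp Require Import all_boot all_order all_algebra.
From mathcomp Require Import reals exp.
From mathcomp Require Import zify.

Set Implicit Arguments.
Unset Strict Implicit.
Unset Printing Implicit Defensive.

(** * Trees presented by a parent map that lowers a depth *)

Definition parent_rel (T : eqType) (p : T -> option T) : rel T :=
  fun x y => (p x == Some y) || (p y == Some x).

Lemma parent_rel_sym (T : eqType) (p : T -> option T) :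
  symmetric (parent_rel p).
Proof. by move=> x y; rewrite /parent_rel orbC. Qed.

Lemma parent_rel_irrefl (T : eqType) (p : T -> option T) (d : T -> nat) :
  (forall x y, p x = Some y -> d y < d x) -> irreflexive (parent_rel p).
Proof.
move=> dp x; rewrite /parent_rel orbb; apply/eqP => /dp.
by rewrite ltnn.
Qed.

(** Passing to the parent lowers [d], so each chain of parents stops, and it can only stop at
    [r]. *)
Lemma parent_rel_connected (T : finType) (p : T -> option T) (d : T -> nat)
    (r : T) :
  (forall x y, p x = Some y -> d y < d x) ->
  (forall x, p x = None -> x = r) ->
  forall x y, connect (parent_rel p) x y.
Proof.
move=> dp pr.
have to_root x : connect (parent_rel p) x r.
  have [n] := ubnP (d x); elim: n x => // n IHn x lt_dx.
  case px: (p x) => [y|]; last by rewrite (pr _ px).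
  apply: (@connect_trans _ _ y); last first.
    by apply: IHn; apply: leq_trans (dp _ _ px) _.
  by apply: connect1; rewrite /parent_rel px eqxx.
have sym : connect_sym (parent_rel p).
  exact/sym_connect_sym/parent_rel_sym.
move=> x y; apply: (connect_trans (to_root x)); by rewrite sym.
Qed.

(* Both cycle neighbours of a vertex of maximal depth must be its parent. *)
Lemma parent_rel_acyclic (T : eqType) (p : T -> option T) (d : T -> nat) :
  (forall x y, p x = Some y -> d y < d x) ->
  forall c : seq T, 2 < size c -> ~ ucycle (parent_rel p) c.
Proof.
move=> dp c sz_c /andP[cyc_c uniq_c].
have [v v_c v_max] : exists2 v, v \in c & forall x, x \in c -> d x <= d v.
  case: c sz_c {cyc_c uniq_c} => // a c _.
  elim: c a => [|b c IHc] a.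
    by exists a; rewrite ?mem_head // => x; rewrite inE => /eqP->.
  have [v v_c v_max] := IHc b.
  have [le_av|lt_va] := leqP (d a) (d v).
    exists v; first by rewrite inE v_c orbT.
    by move=> x; rewrite inE => /predU1P[->//|/v_max].
  exists a; first exact: mem_head.
  move=> x; rewrite inE => /predU1P[->//|/v_max le_xv].
  exact: leq_trans le_xv (ltnW lt_va).
have neighbour x : x \in c -> parent_rel p v x -> p v = Some x.
  move=> /v_max le_xv /orP[/eqP//|/eqP/dp].
  by rewrite ltnNge le_xv.
have [i s rot_c] := rot_to v_c.
have mem_s x : x \in s -> x \in c.
  by move=> x_s; rewrite -(mem_rot i) rot_c inE x_s orbT.
move: cyc_c uniq_c sz_c.
rewrite -(rot_cycle i) -(rot_uniq i) -(size_rot i) rot_c.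
(* The two neighbours of [v] on the cycle, [a] and [last b s], sit at different positions because
   the size exceeds 2; their being equal contradicts uniqueness. *)
case: s mem_s {rot_c} => [|a [|b s]] mem_s //=.
rewrite rcons_path => /and3P[va _ /andP[_ lv]] /and3P[_ a_s _] _.
have pva := neighbour a (mem_s _ (mem_head _ _)) va.
have l_s : last b s \in b :: s by apply: mem_last.
have /neighbour : last b s \in c by apply: mem_s; rewrite inE l_s orbT.
rewrite parent_rel_sym => /(_ lv); rewrite pva => -[a_l].
by move: a_s; rewrite a_l l_s.
Qed.

(** * The tree and the structure of its independent sets *)

Section Spider.

Variables m t : nat.

Definition leg : finType := ('I_m * 'I_t)%type.

(* The summands are, in order: the root, its [m] children (hubs), the [t]
   children of each hub (knees), and the only child of each knee (leaves). *)
Definition spider_vertex : finType := ((unit + 'I_m) + (leg + leg))%type.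

Definition spider_root : spider_vertex := inl (inl tt).
Definition hub (i : 'I_m) : spider_vertex := inl (inr i).
Definition knee (p : leg) : spider_vertex := inr (inl p).
Definition leaf (p : leg) : spider_vertex := inr (inr p).

Definition spider_parent (x : spider_vertex) : option spider_vertex :=
  match x with
  | inl (inl _) => None
  | inl (inr _) => Some spider_root
  | inr (inl p) => Some (hub p.1)
  | inr (inr p) => Some (knee p)
  end.

Definition spider_depth (x : spider_vertex) : nat :=
  match x with
  | inl (inl _) => 0
  | inl (inr _) => 1
  | inr (inl _) => 2
  | inr (inr _) => 3
  end.

Lemma spider_parent_depth x y :
  spider_parent x = Some y -> spider_depth y < spider_depth x.
Proof. by case: x => [[[]|i]|[p|p]] //= [<-]. Qed.

Definition spider : sgraph :=
  SGraph (@parent_rel_sym _ spider_parent)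
         (parent_rel_irrefl spider_parent_depth).

Lemma spider_tree : tree spider.
Proof.
split.
- by apply/card_gt0P; exists spider_root.
- apply: (@parent_rel_connected _ _ _ spider_root spider_parent_depth).
  by case=> [[[]|i]|[p|p]].
- exact: parent_rel_acyclic spider_parent_depth.
Qed.

Definition hubs (A : {set spider}) : {set 'I_m} := [set i | hub i \in A].
Definition knees (A : {set spider}) : {set leg} := [set p | knee p \in A].
Definition leaves (A : {set spider}) : {set leg} := [set p | leaf p \in A].

Lemma card_spider_subset (A : {set spider}) :
  #|A| = (spider_root \in A) + #|hubs A| + (#|knees A| + #|leaves A|).
Proof.
rewrite -!sum1_card big_mkcond !big_sumType /= -!big_mkcond /=.
congr (_ + _ + (_ + _)); try by apply: eq_bigl => x; rewrite inE.
rewrite big_mkcond (big_pred1 tt) => [|[]//].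
by rewrite /spider_root; case: (_ \in _).
Qed.

(** One condition for each kind of edge: root to hub, hub to knee, knee to leaf. *)
Lemma spider_independentP (A : {set spider}) :
  reflect [/\ (spider_root \in A -> hubs A = set0),
              (forall p, p \in knees A -> p.1 \notin hubs A) &
              [disjoint knees A & leaves A]] (independent A).
Proof.
apply: (iffP forall_inP) => [indA|[rA kA dA] x xA].
  have ind x y : x \in A -> y \in A -> ~~ parent_rel spider_parent x y.
    by move=> xA yA; have /forall_inP/(_ y yA) := indA x xA.
  split.
  - move=> rA; apply/setP => i; rewrite !inE; apply/negP => iA.
    by have := ind _ _ rA iA.
  - move=> p; rewrite !inE => pA; apply/negP => hA.
    by have := ind _ _ pA hA; rewrite /parent_rel /= eqxx.
  - apply/pred0P => p /=; rewrite !inE; apply/andP => -[pA lA].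
    by have := ind _ _ lA pA; rewrite /parent_rel /= eqxx.
have no x' y' : x' \in A -> y' \in A -> spider_parent x' == Some y' -> False.
  move=> x'A y'A; case: x' x'A => [[[]|i]|[p|p]] //= x'A /eqP[y'E].
  - by move: y'A; rewrite -y'E => /rA/setP/(_ i); rewrite !inE x'A.
  - by have := kA p; rewrite !inE x'A y'E y'A => /(_ isT).
  - by move/pred0P: dA => /(_ p) /=; rewrite !inE x'A y'E y'A.
apply/forall_inP => y yA; apply/negP => /orP[]; exact: no.
Qed.

Lemma card_leg : #|leg| = t * m.
Proof. by rewrite card_prod !card_ord mulnC. Qed.

(** The legs whose knee stays available once the hubs in [S] are taken. *)
Definition off_hubs (S : {set 'I_m}) : {set leg} := setX (~: S) setT.

Lemma card_off_hubs (S : {set 'I_m}) : #|off_hubs S| = t * (m - #|S|).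
Proof. by rewrite cardsX cardsT card_ord cardsCs setCK card_ord mulnC. Qed.

(** Exactly one end of every pendant edge is taken, so the size does not depend on [F]. *)
Definition spider_set (r : bool) (S : {set 'I_m}) (F : {set leg}) :
  {set spider} :=
  [set x : spider_vertex | match x with
     | inl (inl _) => r
     | inl (inr i) => i \in S
     | inr (inl p) => p \in F
     | inr (inr p) => p \notin F
     end].

Lemma hubs_spider_set r S F : hubs (spider_set r S F) = S.
Proof. by apply/setP => i; rewrite !inE. Qed.

Lemma knees_spider_set r S F : knees (spider_set r S F) = F.
Proof. by apply/setP => i; rewrite !inE. Qed.

Lemma leaves_spider_set r S F : leaves (spider_set r S F) = ~: F.
Proof. by apply/setP => i; rewrite !inE. Qed.

Lemma spider_set_independent (r : bool) S (F : {set leg}) :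
  (r -> S = set0) -> F \subset off_hubs S -> independent (spider_set r S F).
Proof.
move=> rS /subsetP FS; apply/spider_independentP.
rewrite hubs_spider_set knees_spider_set leaves_spider_set; split.
- by rewrite inE.
- by move=> p /FS; rewrite !inE andbT.
- by rewrite -subsets_disjoint.
Qed.

Lemma card_spider_set (r : bool) S F :
  #|spider_set r S F| = r + #|S| + t * m.
Proof.
rewrite card_spider_subset hubs_spider_set knees_spider_set leaves_spider_set.
by rewrite inE /= cardsC card_leg.
Qed.

(** Each [F] inside [off_hubs S] yields such a set, and [F] is recovered as its set of knees. *)
Lemma spider_indep_count_ge (r : bool) (S : {set 'I_m}) :
  (r -> S = set0) ->
  2 ^ (t * (m - #|S|)) <= indep_count spider (t * m + (r + #|S|)).
Proof.
move=> rS; rewrite -card_off_hubs -card_powerset.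
rewrite -(@card_in_imset _ _ (spider_set r S)); last first.
  by move=> F G _ _ eqFG; rewrite -(knees_spider_set r S F) eqFG knees_spider_set.
apply/subset_leq_card/subsetP => _ /imsetP[F FS ->].
rewrite inE powersetE in FS *.
by rewrite spider_set_independent //= card_spider_set addnC.
Qed.

Lemma card_disjoint_legs (A : {set spider}) :
  [disjoint knees A & leaves A] ->
  #|knees A| + #|leaves A| + #|~: (knees A :|: leaves A)| = t * m.
Proof.
by rewrite -leq_card_setU => /eqP <-; rewrite cardsC card_leg.
Qed.

(** With the root there are no hubs, so the size is at most [1 + t * m]; without it, at most
    [m + t * m], attained by all hubs and all leaves. *)
Lemma spider_alpha : 0 < m -> alpha spider = (1 + t) * m.
Proof.
move=> m_gt0; apply/eqP; rewrite eqn_leq; apply/andP; split.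
  apply/bigmax_leqP => A /spider_independentP[rA _ /card_disjoint_legs].
  have := max_card (hubs A); rewrite card_ord card_spider_subset.
  by case: (spider_root \in A) rA => [->//|_]; rewrite ?cards0; lia.
apply: leq_trans (leq_bigmax_cond (spider_set false setT set0) _).
  by rewrite card_spider_set cardsT card_ord mulnDl mul1n.
by apply: spider_set_independent; rewrite ?sub0set.
Qed.

(* A set of this size misses the root, and is determined by its hubs, by the
   [#|hubs A| - 2] legs it misses, and by the knees it takes. *)
Lemma spider_indep_count_le :
  indep_count spider (t * m + 2) <=
  \sum_(S : {set 'I_m} | 2 <= #|S|)
    'C(t * m, #|S| - 2) * 2 ^ (t * (m - #|S|)).
Proof.
pose code (A : {set spider}) :=
  (hubs A, (~: (knees A :|: leaves A), knees A)).
pose D := [set A : {set spider} | independent A & #|A| == t * m + 2].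
have D_spec A : A \in D -> [/\ spider_root \notin A,
    2 <= #|hubs A|, #|~: (knees A :|: leaves A)| = #|hubs A| - 2,
    knees A \subset off_hubs (hubs A) & [disjoint knees A & leaves A]].
  rewrite inE => /andP[/spider_independentP[rA kA dA]].
  have := card_disjoint_legs dA; rewrite card_spider_subset => cA.
  case rE: (spider_root \in A) => /eqP sA.
    by move: sA; rewrite rA // cards0; lia.
  split=> //; try by move: sA cA; lia.
  by apply/subsetP => p /kA; rewrite !inE => ->.
have code_inj : {in D &, injective code}.
  move=> A B /D_spec[rA _ _ _ dA] /D_spec[rB _ _ _ dB] [hAB uAB kAB].
  (* A leg that is neither missed nor represented by its knee is represented by its leaf. *)
  have lAB : leaves A = leaves B.
    have lE (C : {set spider}) : [disjoint knees C & leaves C] ->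
        leaves C = ~: (~: (knees C :|: leaves C) :|: knees C).
      move/pred0P => dC; apply/setP => p; have := dC p; rewrite !inE /=.
      by case: (knee p \in C); case: (leaf p \in C).
    by rewrite (lE A) // (lE B) // uAB kAB.
  apply/setP => -[[[]|i]|[p|p]].
  - by rewrite (negPf rA) (negPf rB).
  - by move/setP/(_ i): hAB; rewrite !inE.
  - by move/setP/(_ p): kAB; rewrite !inE.
  - by move/setP/(_ p): lAB; rewrite !inE.
rewrite -[indep_count _ _]/#|D| -(card_in_imset code_inj).
(* Missed legs and knees are chosen without requiring disjointness; this overcounts, which an upper
   bound allows. *)
pose E (S : {set 'I_m}) : {set {set leg} * {set leg}} :=
  setX [set U : {set leg} | #|U| == #|S| - 2] (powerset (off_hubs S)).
have E_card S : #|E S| = 'C(t * m, #|S| - 2) * 2 ^ (t * (m - #|S|)).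
  by rewrite cardsX card_draws card_leg card_powerset card_off_hubs.
under eq_bigr => S _ do rewrite -E_card -sum1_card.
rewrite pair_big_dep /= -sum1_card.
rewrite [leqRHS](big_mkcond _ _) [leqLHS]big_mkcond /=.
apply: leq_sum => -[S [U F]] _ /=; case: imsetP => // -[A /D_spec[_ h2 uA kA _]].
by case=> -> -> ->; rewrite h2 !inE /= uA eqxx kA.
Qed.

End Spider.

(** * Numerical estimates and the failure of log-concavity *)

Lemma leq_bin_expn n k : 'C(n, k) <= n ^ k.
Proof.
elim: k => [|k IHk]; first by rewrite bin0.
apply: leq_trans (leq_pmull _ (ltn0Sn k)) _.
by rewrite mul_bin_left expnS leq_mul // leq_subr.
Qed.

(** The term [i = 0] dominates: the others form [b] times the sum for the preceding [n], and
    [2 * b <= q] absorbs the factor 2. *)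
Lemma geometric_sum_leq b q n : 2 * b <= q ->
  \sum_(i < n.+1) b ^ i * q ^ (n - i) <= 2 * q ^ n.
Proof.
move=> le_bq; elim: n => [|n IHn]; first by rewrite big_ord1.
rewrite big_ord_recl /= mul1n subn0.
under eq_bigr => i _ do rewrite /bump /= add1n subSS expnS -mulnA.
rewrite -big_distrr /= mul2n -addnn leq_add2l.
apply: leq_trans (leq_mul (leqnn b) IHn) _.
by rewrite mulnCA mulnA expnS leq_mul2r le_bq orbT.
Qed.

(** Grouping by [i = #|S| - 2] and bounding binomials by powers gives terms [m ^ 2 * (t * m ^ 2) ^ i
    * q ^ (m - 2 - i)] with [q = 2 ^ t], a geometric sum. *)
Lemma spider_indep_count_bound m t : 2 <= m -> 2 * (t * m ^ 2) <= 2 ^ t ->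
  indep_count (spider m t) (t * m + 2) <= 2 * m ^ 2 * (2 ^ t) ^ (m - 2).
Proof.
move=> m_ge2 small; apply: leq_trans (spider_indep_count_le m t) _.
(* [inord] never falls back on its default, since [#|S| <= m]. *)
rewrite (partition_big (fun S : {set 'I_m} => inord (#|S| - 2) : 'I_(m - 2).+1)
  xpredT) //=.
rewrite [leqRHS]mulnAC.
apply: leq_trans (leq_mul (geometric_sum_leq (m - 2) small) (leqnn (m ^ 2))).
rewrite big_distrl /=; apply: leq_sum => i _.
have lt_i := ltn_ord i.
have hubs_i (S : {set 'I_m}) :
    (2 <= #|S|) && (inord (#|S| - 2) == i) -> #|S| = i + 2.
  have := max_card S; rewrite card_ord => le_S /andP[ge_S /eqP/(congr1 val)].
  by rewrite /= inordK => [<-|]; rewrite ?subnK // ltnS leq_sub2r.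
apply: (@leq_trans (\sum_(S : {set 'I_m} | #|S| == i + 2)
    'C(t * m, i) * 2 ^ (t * (m - (i + 2))))).
  rewrite big_mkcond [leqRHS]big_mkcond /=; apply: leq_sum => S _.
  by case: ifP => // /hubs_i ->; rewrite eqxx addnK.
rewrite sum_nat_cond_const card_draws card_ord.
apply: leq_trans (leq_mul (leq_bin_expn _ _)
  (leq_mul (leq_bin_expn _ _) (leqnn _))) _.
rewrite expnM (_ : m - (i + 2) = m - 2 - i); last lia.
rewrite -[m ^ 2 in leqRHS]/(m * m) [t * (m * m)]mulnA.
rewrite [(t * m * m) ^ i]expnMn expnD.
move: ((t * m) ^ i) (m ^ i) ((2 ^ t) ^ _) => a b c.
by rewrite -[m ^ 2]/(m * m); lia.
Qed.

Lemma spider_log_concavity_broken m t :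
  3 <= m -> 2 * (t * m ^ 2) <= 2 ^ t -> 4 * m ^ 4 < 2 ^ t ->
  log_concavity_broken_at (indep_count (spider m t)) (t * m + 2).
Proof.
move=> m_ge3 small1 small2; rewrite /log_concavity_broken_at addn2 /=.
have lower1 : (2 ^ t) ^ m <= indep_count (spider m t) (t * m).+1.
  have := @spider_indep_count_ge m t true set0 (fun=> erefl).
  by rewrite cards0 subn0 expnM addn1.
have lower3 : (2 ^ t) ^ (m - 3) <= indep_count (spider m t) (t * m).+3.
  have [S S3] : exists S : {set 'I_m}, #|S| = 3.
    have : 0 < #|[set S : {set 'I_m} | #|S| == 3]|.
      by rewrite card_draws card_ord bin_gt0.
    by case/card_gt0P => S; rewrite inE => /eqP; exists S.
  have := @spider_indep_count_ge m t false S (fun H => False_ind _ (notF H)).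
  by rewrite S3 expnM add0n addn3.
have := spider_indep_count_bound (ltnW m_ge3) small1; rewrite addn2 => upper.
apply: leq_trans (leq_mul lower1 lower3).
apply: leq_ltn_trans (leq_mul upper upper) _.
have q_gt0 : 0 < 2 ^ t by rewrite expn_gt0.
move: small2 q_gt0; move: (2 ^ t) => q small2 q_gt0.
(* The lower bounds carry one more factor [q] than the squared upper bound, and it beats
   [4 * m ^ 4]. *)
have -> : q ^ m * q ^ (m - 3) = q * (q ^ (m - 2) * q ^ (m - 2)).
  by rewrite -!expnD -expnS; congr (_ ^ _); lia.
have -> : 2 * m ^ 2 * q ^ (m - 2) * (2 * m ^ 2 * q ^ (m - 2)) =
  4 * m ^ 4 * (q ^ (m - 2) * q ^ (m - 2)) by rewrite -[4]/(2 + 2) expnD; lia.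
by rewrite ltn_pmul2r // muln_gt0 !expn_gt0 q_gt0.
Qed.

(** * Bounds on the integer part of [2 ^ (t / 16)] and the choice of threshold *)

Import Order.TTheory GRing.Theory Num.Theory.

Lemma floor_pow2_16_exp (R : realType) (t : nat) :
  floor_pow2_16 R t ^ 16 <= 2 ^ t.
Proof.
rewrite -(ler_nat R) !natrX /floor_pow2_16.
have -> : (2%:R ^+ t = powR (2%:R : R) (t%:R / 16%:R) ^+ 16)%R.
  by rewrite -[RHS]powR_mulrn ?powR_ge0 // -powRrM divfK ?pnatr_eq0 // powR_mulrn.
by apply: lerXn2r; rewrite ?nnegrE ?powR_ge0 // truncn_le powR_ge0.
Qed.

Lemma floor_pow2_16_ge (R : realType) (t n : nat) :
  16 * n <= t -> 2 ^ n <= floor_pow2_16 R t.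
Proof.
move=> le_nt; rewrite /floor_pow2_16 truncn_ge_nat ?powR_ge0 // natrX.
rewrite -powR_mulrn //; apply: ler_powR; first by rewrite ler1n.
by rewrite ler_pdivlMr ?ltr0n // -natrM ler_nat mulnC.
Qed.

(** Equality holds at [n = 8]; from there on, doubling outgrows the step from [n ^ 2] to
    [n.+1 ^ 2]. *)
Lemma square_le_exp2 n : 8 <= n -> 4 * n ^ 2 <= 2 ^ n.
Proof.
move=> /subnKC <-; elim: (n - 8) => // k IHk.
rewrite addnS expnS; apply: leq_trans (leq_mul (leqnn 2) IHk).
nia.
Qed.

Theorem theorem1p3 (R : realType) :
  exists t0 : nat, forall t : nat, t0 <= t ->
    exists T : sgraph,
      [/\ tree T,
          alpha T = (1 + t) * floor_pow2_16 R t &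
          log_concavity_broken_at (indep_count T) (t * floor_pow2_16 R t + 2)].
Proof.
(* [32 = 16 * 2] forces [m >= 2 ^ 2]. *)
exists 32 => t le_t.
have m_ge4 : 4 <= floor_pow2_16 R t by apply: (@floor_pow2_16_ge R t 2).
have m16 := floor_pow2_16_exp R t.
move: (floor_pow2_16 R t) m_ge4 m16 => m m_ge4 m16.
have le_pow k : k <= 16 -> m ^ k <= 2 ^ t.
  by move=> le_k; apply: leq_trans m16; rewrite leq_pexp2l //; lia.
exists (spider m t); split; [exact: spider_tree|apply: spider_alpha; lia|].
apply: spider_log_concavity_broken; first lia.
- have t2 : 4 * t ^ 2 <= 2 ^ t by apply: square_le_exp2; lia.
  (* Squaring splits the goal into [4 * t ^ 2 <= 2 ^ t] and [m ^ 4 <= 2 ^ t]. *)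
  rewrite -(leq_exp2r _ _ (isT : 0 < 2)).
  have -> : (2 * (t * m ^ 2)) ^ 2 = 4 * t ^ 2 * m ^ 4.
    by rewrite -[4 in RHS]/(2 * 2) expnM; lia.
  by rewrite -[leqRHS]/(2 ^ t * 2 ^ t) leq_mul // le_pow.
(* Since [m >= 4], the factor [m ^ 2] exceeds 4, so [4 * m ^ 4 < m ^ 6]. *)
- apply: leq_trans (le_pow 6 isT).
  have : 0 < m ^ 4 by rewrite expn_gt0; lia.
  by rewrite -[6]/(4 + 2) expnD; nia.
Qed.
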